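(* Let $G$ be a finite simple connected graph with $m\ge 1$ edges, maximum degree $\Delta$ and minimum degree $\delta$, and let $\alpha\in\mathbb{R}\setminus\{0\}$. Then $$GA_1(G)\ge \delta^{-2\alpha}\, m\, NK^*(G)^{\alpha/m}\quad\text{if } \alpha\le -1/2,$$ $$GA_1(G)\ge \delta\,\Delta^{-2\alpha-1}\, m\, NK^*(G)^{\alpha/m}\quad\text{if } \alpha\ge -1/2,$$ and in each case the equality holds if and only if $G$ is regular.
   Context: For a graph $G$ with vertex set $V(G)$ and edge set $E(G)$, $d_u$ denotes the degree of the vertex $u$. The first geometric-arithmetic index is $GA_1(G)=\sum_{uv\in E(G)}\frac{2\sqrt{d_ud_v}}{d_u+d_v}$. The modified Narumi-Katayama index is $NK^*(G)=\prod_{u\in V(G)}d_u^{d_u}=\prod_{uv\in E(G)}d_ud_v$. *)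

(* Defs.v *)
From HB Require Import structures.
From mathcomp Require Import reals.
From mathcomp Require Import all_boot all_order all_algebra.

Set Implicit Arguments.
Unset Strict Implicit.
Unset Printing Implicit Defensive.

Import Order.TTheory GRing.Theory Num.Theory.
Local Open Scope ring_scope.

(* A finite simple graph is a symmetric irreflexive relation e : rel T on a
   finite type T of vertices. *)

Definition degree (T : finType) (e : rel T) (u : T) : nat := #|[set v | e u v]|.

(* The edges are the unordered pairs {u, v} with u adjacent to v. *)
Definition edges (T : finType) (e : rel T) : {set {set T}} :=
  [set [set u; v] | u in T, v in e u].

Lemma edgesP (T : finType) (e : rel T) (A : {set T}) :
  reflect (exists u v : T, e u v /\ A = [set u; v]) (A \in edges e).
Proof.
apply: (iffP imset2P); first by move=> [u v _ uv ->]; exists u, v.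
by move=> [u [v [uv ->]]]; exists u v.
Qed.

Definition max_degree (T : finType) (e : rel T) : nat := \max_(u : T) degree e u.

(* No degree exceeds #|T|, so the default value #|T| is only reached when T is
   empty. *)
Definition min_degree (T : finType) (e : rel T) : nat :=
  \big[minn/#|T|]_(u : T) degree e u.

Definition connected_graph (T : finType) (e : rel T) : Prop :=
  forall u v : T, connect e u v.

Definition regular (T : finType) (e : rel T) : Prop :=
  exists k : nat, forall u : T, degree e u = k.

(* For an edge A = {u, v} of a simple graph, u != v, so the product and the sum
   over A are d_u * d_v and d_u + d_v. *)
Definition GA1 (R : realType) (T : finType) (e : rel T) : R :=
  \sum_(A in edges e)
    2 * Num.sqrt (\prod_(u in A) (degree e u)%:R)
      / (\sum_(u in A) (degree e u)%:R).

Definition NKstar (T : finType) (e : rel T) : nat :=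
  (\prod_(u : T) degree e u ^ degree e u)%N.

Lemma min_degree_le (T : finType) (e : rel T) (u : T) :
  (min_degree e <= degree e u)%N.
Proof.
rewrite /min_degree; have := mem_index_enum u.
elim: (index_enum T) => [//|x s IH]; rewrite inE big_cons geq_min.
by case/orP=> [/eqP <-|/IH ->]; rewrite ?leqnn ?orbT.
Qed.

Lemma min_degree_attained (T : finType) (e : rel T) (u0 : T) :
  exists u : T, min_degree e = degree e u.
Proof.
rewrite /min_degree.
have: \big[minn/#|T|]_(u : T) degree e u = #|T|
   \/ exists u, \big[minn/#|T|]_(u : T) degree e u = degree e u.
  elim/big_rec: _ => [|u x _ IH]; first by left.
  rewrite /minn; case: ifP => _; first by right; exists u.
  exact: IH.
case=> // minT; exists u0; apply/eqP; rewrite eqn_leq.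
by rewrite (min_degree_le e u0) minT max_card.
Qed.

(* Main.v *)
(* Write q for the geometric mean and H for the harmonic mean of the degrees at
   the ends of an edge, and put g = -2 alpha - 1.  As H = q^2 / ((d_u + d_v)/2),
   the term of the edge in GA_1 is q / ((d_u + d_v)/2) = H q^g (d_u d_v)^alpha.
   Here H >= delta, with equality iff d_u = d_v = delta, and q^g is bounded below
   by delta^g or Delta^g according to the sign of g.  It remains to sum over the
   edges and to apply AM-GM to the numbers (d_u d_v)^alpha, whose product is
   NK*^alpha.  Equality forces H = delta on every edge; as no vertex is
   isolated, G is then regular. *)
Require Import Defs.
From HB Require Import structures.
From mathcomp Require Import reals exp.
From mathcomp Require Import all_boot all_order all_algebra.
From mathcomp Require Import ring lra.

Set Implicit Arguments.
Unset Strict Implicit.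
Unset Printing Implicit Defensive.

Import Order.TTheory GRing.Theory Num.Theory.
Local Open Scope ring_scope.

(** Multiplied by [x + y], the difference of the two sides is [x * (y - d) + y * (x - d)], a sum of
    nonnegative terms that vanishes only when both do. *)
Lemma leif_harmonic_mean (R : realFieldType) (d x y : R) :
  0 < d -> d <= x -> d <= y ->
  d <= 2 * (x * y) / (x + y) ?= iff (x == d) && (y == d).
Proof.
move=> d0 dx dy; have [x0 y0 xy0] : [/\ 0 < x, 0 < y & 0 < x + y] by split; lra.
have E : 2 * (x * y) - d * (x + y) = x * (y - d) + y * (x - d) by ring.
split.
  rewrite ler_pdivlMr// -subr_ge0 E addr_ge0// mulr_ge0//; lra.
apply/eqP/andP => [dE|[/eqP-> /eqP->]]; last by field; lra.
have : x * (y - d) + y * (x - d) = 0.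
  by rewrite -E dE divfK ?subrr// gt_eqF.
have h1 : 0 <= x * (y - d) by rewrite mulr_ge0//; lra.
have h2 : 0 <= y * (x - d) by rewrite mulr_ge0//; lra.
move=> h; have {h1 h2 h} [/eqP h1 /eqP h2] : x * (y - d) = 0 /\ y * (x - d) = 0.
  by split; lra.
by move: h1 h2; rewrite !mulf_eq0 !subr_eq0 (gt_eqF x0) (gt_eqF y0).
Qed.

Lemma le0_ler_powR (R : realType) (r x y : R) :
  r <= 0 -> 0 < x -> x <= y -> y `^ r <= x `^ r.
Proof.
move=> r0 x0 xy; have y0 := lt_le_trans x0 xy.
rewrite -[r]opprK (powRN x) (powRN y) lef_pV2 ?posrE ?powR_gt0//.
by rewrite ge0_ler_powR ?oppr_ge0 ?nnegrE ?(ltW x0) ?(ltW y0).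
Qed.

Lemma prod_powR (R : realType) (I : finType) (A : {pred I}) (E : I -> R) (r : R) :
  {in A, forall i, 0 <= E i} ->
  \prod_(i in A) E i `^ r = (\prod_(i in A) E i) `^ r.
Proof.
move=> E0; suff [] : 0 <= \prod_(i in A) E i /\
  \prod_(i in A) E i `^ r = (\prod_(i in A) E i) `^ r by [].
apply: (big_rec2 (fun a b => 0 <= b /\ a = b `^ r)); first by rewrite powR1.
by move=> i a b Ai [b0 ->]; rewrite mulr_ge0 ?E0// powRM ?E0.
Qed.

Lemma AGM_powR (R : realType) (I : finType) (A : {pred I}) (E : I -> R) (r : R) :
  (0 < #|A|)%N -> {in A, forall i, 0 <= E i} ->
  #|A|%:R * (\prod_(i in A) E i) `^ (r / #|A|%:R) <= \sum_(i in A) E i `^ r.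
Proof.
move=> A0 E0; have n0 : 0 < #|A|%:R :> R by rewrite ltr0n.
have := @leif_AGM R I A (fun i => E i `^ r) (fun i _ => powR_ge0 _ _).
set mu := (_ / _) => -[+ _].
have mu0 : 0 <= mu by rewrite divr_ge0 ?ler0n ?sumr_ge0// => i _; apply: powR_ge0.
rewrite prod_powR// mulrC -ler_pdivlMr// -/mu powRrM => h.
(* AM-GM bounds the product by [mu ^+ #|A|]; the claim follows by taking the [#|A|]-th root, which
   is monotone. *)
rewrite -[leRHS](_ : (mu ^+ #|A|) `^ (#|A|%:R^-1) = mu).
  by rewrite ge0_ler_powR ?invr_ge0 ?ler0n ?nnegrE ?powR_ge0 ?exprn_ge0.
by rewrite -powR_mulrn// -powRrM divff ?powRr1// gt_eqF.
Qed.

Lemma edge_term_lower_bound (R : realType) (alpha b d x y : R) :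
  let g := - 2 * alpha - 1 in
  let c := d * b `^ g * (x * y) `^ alpha in
  let f := 2 * Num.sqrt (x * y) / (x + y) in
  0 < b -> 0 < d -> d <= x -> d <= y -> b `^ g <= Num.sqrt (x * y) `^ g ->
  c <= f /\ (c = f -> x = d).
Proof.
move=> g c f b0 d0 dx dy bg.
have p0 : 0 < x * y by rewrite mulr_gt0//; lra.
have H := leif_harmonic_mean d0 dx dy; set h := 2 * (x * y) / (x + y) in H.
have -> : f = h * Num.sqrt (x * y) `^ g * (x * y) `^ alpha.
  (* The choice of [g] makes the exponents balance: [1 + g / 2 + alpha = 1 / 2]. *)
  have E : x * y * ((x * y) `^ (2^-1 * g) * (x * y) `^ alpha) = (x * y) `^ 2^-1.
    rewrite -{1}[x * y]powRr1 ?ltW// -!powRD ?(gt_eqF p0) ?implybT//.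
    by congr (_ `^ _); rewrite /g; field.
  by rewrite /f /h -powR12_sqrt ?ltW// -powRrM -E; field; lra.
have a0 := powR_gt0 alpha p0; have c0 := powR_gt0 g b0.
have dh : d * b `^ g <= h * b `^ g by rewrite ler_pM2r ?H.
have hh : h * b `^ g <= h * Num.sqrt (x * y) `^ g.
  by rewrite ler_pM2l// (lt_le_trans d0) ?H.
split; first by rewrite /c ler_pM2r// (le_trans dh).
(* Equality of the two ends collapses the chain [dh], [hh], so that [h = d] and the equality case of
   the harmonic mean applies. *)
move=> /(mulIf (lt0r_neq0 a0)) ceq.
have /(mulIf (lt0r_neq0 c0))/eqP : d * b `^ g = h * b `^ g.
  by apply/eqP; rewrite eq_le dh ceq hh.
by rewrite H => /andP[/eqP].
Qed.

Section Graph.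
Variables (T : finType) (e : rel T).
Hypotheses (e_sym : symmetric e) (e_irr : irreflexive e).

Lemma adj_neq (u v : T) : e u v -> u != v.
Proof. by apply: contraTneq => ->; rewrite e_irr. Qed.

(** The map sending [v] to [[set u; v]] is a bijection from the neighbours of [u] to the edges at
    [u]; it is injective because [v != u]. *)
Lemma card_incident_edges (u : T) : #|[set A in edges e | u \in A]| = degree e u.
Proof.
rewrite /degree -(card_in_imset (f := fun v => [set u; v])).
  apply: eq_card => A; rewrite !inE; apply/andP/imsetP.
    move=> [/edgesP[x [y [xy ->]]]]; rewrite !inE => /orP[]/eqP uE.
      by exists y; rewrite ?inE uE.
    by exists x; rewrite ?inE uE 1?e_sym// setUC.
  move=> [v]; rewrite inE => uv ->; rewrite set21; split=> //.
  by apply/edgesP; exists u, v.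
move=> v w; rewrite !inE => uv _ /setP/(_ v); rewrite !inE eqxx orbT.
by rewrite eq_sym (negbTE (adj_neq uv)) => /esym/eqP.
Qed.

(** Double counting: after exchanging the products, the factor [degree e u] occurs once for each
    edge at [u]. *)
Lemma NKstar_edges : NKstar e = (\prod_(A in edges e) \prod_(u in A) degree e u)%N.
Proof.
rewrite (exchange_big_dep predT)//=; apply: eq_bigr => u _.
rewrite prod_nat_const -[in X in (_ ^ X)%N](card_incident_edges u).
by congr (_ ^ _)%N; apply: eq_card => A; rewrite !inE.
Qed.

Lemma big_edge (R : Type) (idx : R) (op : Monoid.com_law idx) (F : T -> R)
  (u v : T) : e u v -> \big[op/idx]_(w in [set u; v]) F w = op (F u) (F v).
Proof. by move=> uv; rewrite big_setU1 ?inE ?adj_neq// big_set1. Qed.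

(** Some end of an edge differs from [u]; the first step of a path from [u] to it gives the
    neighbour. *)
Lemma connected_neighbor (u : T) :
  connected_graph e -> (0 < #|edges e|)%N -> exists v, e u v.
Proof.
move=> e_conn /card_gt0P[A /edgesP[x [y [xy _]]]].
have [w uw] : exists w, u != w.
  have [->|ux] := eqVneq u x; last by exists x.
  by exists y; apply: adj_neq.
have /connectP[[|v p] /= + wE] := e_conn u w; first by rewrite wE eqxx in uw.
by move=> /andP[uv _]; exists v.
Qed.

(* [b] plays the role of [delta] when [g >= 0] and of [Delta] when [g <= 0]. *)
Lemma GA1_lower_bound (R : realType) (alpha : R) (b : nat) :
  let g := - 2 * alpha - 1 in
  let c := (min_degree e)%:R * b%:R `^ g * #|edges e|%:R
           * (NKstar e)%:R `^ (alpha / #|edges e|%:R) in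
  connected_graph e -> (0 < #|edges e|)%N ->
  (0 < b)%N -> (forall k, (forall u, degree e u = k) -> b = k) ->
  (forall u v, e u v ->
    b%:R `^ g <= Num.sqrt ((degree e u)%:R * (degree e v)%:R) `^ g) ->
  c <= GA1 R e /\ (GA1 R e = c <-> regular e).
Proof.
move=> g c e_conn m0 b0 breg bg.
pose P (A : {set T}) : R := \prod_(u in A) (degree e u)%:R.
pose f (A : {set T}) : R := 2 * Num.sqrt (P A) / \sum_(u in A) (degree e u)%:R.
have nb u := connected_neighbor u e_conn m0.
have deg0 u : (0 < degree e u)%N.
  by have [v uv] := nb u; apply/card_gt0P; exists v; rewrite inE.
have [u0 _] : exists u : T, true.
  by have /card_gt0P[A /edgesP[u _]] := m0; exists u.
have d0 : (0 < min_degree e)%N.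
  by have [u ->] := min_degree_attained e u0; apply: deg0.
have P0 A : 0 <= P A by rewrite prodr_ge0// => *; apply: ler0n.
have NKE : (NKstar e)%:R = \prod_(A in edges e) P A.
  by rewrite NKstar_edges natr_prod; apply: eq_bigr => A _; rewrite natr_prod.
pose c' A := (min_degree e)%:R * b%:R `^ g * P A `^ alpha.
have term u v : e u v ->
    c' [set u; v] <= f [set u; v] /\
    (c' [set u; v] = f [set u; v] -> (degree e u)%:R = (min_degree e)%:R :> R).
  move=> uv; rewrite /c' /f /P !big_edge//=.
  by apply: edge_term_lower_bound; rewrite ?ltr0n ?ler_nat ?min_degree_le ?bg.
have cf A : A \in edges e -> c' A <= f A.
  by move=> /edgesP[u [v [uv ->]]]; have [] := term u v uv.
have cc' : c <= \sum_(A in edges e) c' A.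
  rewrite -mulr_sumr /c -mulrA ler_wpM2l ?mulr_ge0 ?powR_ge0//.
  by rewrite NKE AGM_powR// => A _; apply: P0.
have c'f : \sum_(A in edges e) c' A <= GA1 R e by apply: ler_sum.
split; first exact: le_trans c'f.
split=> [cE|[k kE]].
  (* If [GA1 R e = c], the sums of [c'] and [f] agree, hence so do their terms on every edge. *)
  have [_ /esym] := leif_sum (fun A Ae => leif_eq (cf A Ae)).
  rewrite (@eq_le _ R) c'f -[X in X <= _]/(GA1 R e) cE cc' /= => /forallP eqA.
  exists (min_degree e) => u; have [v uv] := nb u.
  have /implyP/(_ _)/eqP eq_uv := eqA [set u; v].
  apply/eqP; rewrite -(eqr_nat R); apply/eqP.
  by apply: (term u v uv).2; apply: eq_uv; apply/edgesP; exists u, v.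
(* Conversely, in a [k]-regular graph every edge contributes 1 to [GA1], and the powers of [k] in
   [c] cancel since [1 + g + 2 * alpha = 0]. *)
have k0 : 0 < k%:R :> R by rewrite -(kE u0) ltr0n.
have PE A : A \in edges e -> P A = k%:R ^+ 2.
  by move=> /edgesP[u [v [uv ->]]]; rewrite /P big_edge// !kE.
have fE A : A \in edges e -> f A = 1.
  move=> Ae; rewrite /f PE// sqrtr_sqr gtr0_norm//.
  have /edgesP[u [v [uv ->]]] := Ae; rewrite big_edge//= !kE.
  by field; lra.
rewrite /GA1 (eq_bigr _ fE) sumr_const /c.
have [u ->] := min_degree_attained e u0; rewrite kE (breg _ kE).
have k1 : k%:R != 0 :> R by rewrite gt_eqF.
have m1 : #|edges e|%:R != 0 :> R by rewrite pnatr_eq0 -lt0n.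
rewrite NKE (eq_bigr _ PE) prodr_const -exprM -powR_mulrn ?ltW// -powRrM.
rewrite -{1}[k%:R]powRr1 ?ltW// mulrAC -!powRD ?k1 ?implybT//.
rewrite (_ : _ + _ = 0) ?powRr0 ?mul1r// /g natrM; field; exact: m1.
Qed.
End Graph.

Theorem corollary2p16 (R : realType) (T : finType) (e : rel T)
  (e_sym : symmetric e) (e_irr : irreflexive e) (e_conn : connected_graph e)
  (m Delta delta : nat)
  (mE : m = #|edges e|) (m_ge1 : (1 <= m)%N)
  (DeltaE : Delta = max_degree e) (deltaE : delta = min_degree e)
  (alpha : R) (alpha_neq0 : alpha != 0) :
  (alpha <= - (1 / 2) ->
     GA1 R e >= delta%:R `^ (- 2 * alpha) * m%:R
                * (NKstar e)%:R `^ (alpha / m%:R)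
     /\ (GA1 R e = delta%:R `^ (- 2 * alpha) * m%:R
                   * (NKstar e)%:R `^ (alpha / m%:R)
         <-> regular e))
  /\
  (alpha >= - (1 / 2) ->
     GA1 R e >= delta%:R * Delta%:R `^ (- 2 * alpha - 1) * m%:R
                * (NKstar e)%:R `^ (alpha / m%:R)
     /\ (GA1 R e = delta%:R * Delta%:R `^ (- 2 * alpha - 1) * m%:R
                   * (NKstar e)%:R `^ (alpha / m%:R)
         <-> regular e)).
Proof.
subst m Delta delta.
have nb u := connected_neighbor e_irr u e_conn m_ge1.
have deg0 u : (0 < degree e u)%N.
  by have [v uv] := nb u; apply/card_gt0P; exists v; rewrite inE.
have [u0 _] : exists u : T, true.
  by have /card_gt0P[A /edgesP[u _]] := m_ge1; exists u.
have [umin uminE] := min_degree_attained e u0.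
have maxE u : (degree e u <= max_degree e)%N := leq_bigmax u.
have d0 : (0 < min_degree e)%N by rewrite uminE.
have D0 : (0 < max_degree e)%N := leq_trans (deg0 u0) (maxE u0).
have dd0 : 0 < (min_degree e)%:R :> R by rewrite ltr0n.
split=> ha.
  (* Splitting off one factor brings the bound to the general form with [b = min_degree e]; here
     [g >= 0], so [b] at most the geometric mean suffices. *)
  have -> : (min_degree e)%:R `^ (- 2 * alpha) =
      (min_degree e)%:R * (min_degree e)%:R `^ (- 2 * alpha - 1) :> R.
    rewrite -{2}[(min_degree e)%:R]powRr1 ?ler0n// -powRD ?(gt_eqF dd0) ?implybT//.
    by rewrite addrC subrK.
  apply: (GA1_lower_bound e_sym e_irr) => // [k kE|u v uv]; first by rewrite uminE.
  rewrite ge0_ler_powR ?nnegrE ?sqrtr_ge0//; first lra.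
  rewrite -[leLHS]gtr0_norm// -sqrtr_sqr ler_wsqrtr//.
  by rewrite expr2 ler_pM ?ler0n// ler_nat min_degree_le.
(* Here [g <= 0] reverses the order of powers, so [b = max_degree e], at least the geometric mean,
   is the right choice. *)
apply: (GA1_lower_bound e_sym e_irr) => // [k kE|u v uv].
  apply/eqP; rewrite eqn_leq -{2}(kE u0) maxE andbT.
  by apply/bigmax_leqP => u _; rewrite kE.
apply: le0_ler_powR; first lra.
  by rewrite sqrtr_gt0 mulr_gt0 ?ltr0n.
rewrite -[leRHS]ger0_norm// -sqrtr_sqr ler_wsqrtr//.
by rewrite expr2 ler_pM ?ler0n// ler_nat maxE.
Qed.
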